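(* Let $K$ be a perfect field, let $A=(A_1,\dots,A_m)$ be an $m$-tuple of $p\times q$ matrices over $K$, and let $T_A=\sum_{i=1}^m A_i\otimes[i]\in K^p\otimes K^q\otimes K^m$. If $\ell$ is a real number with $\ell\ge\min\{p,q\}$ and $\alpha=(1,1,\ell)$, then $$\operatorname{ncrk}(A)=\operatorname{rk}^G_\alpha(T_A).$$
   Context: Here $m,p,q\geq 1$; $K^{p\times q}$ is identified with $K^p\otimes K^q$ in the standard way (the matrix with a single entry $1$ in position $(a,b)$ corresponds to $[a]\otimes[b]$), and $[1],\dots,[m]$ is the standard basis of $K^m$. Non-commutative rank: $\operatorname{ncrk}(A)$ is the minimal value of $q+\dim\left(\sum_{i=1}^m A_i(W)\right)-\dim W$ over all subspaces $W\subseteq K^q$. $G$-stable rank of a tensor $u\in U=U_1\otimes\cdots\otimes U_d$ ($U_i$ finite-dimensional over $K$) with weight $\alpha\in\mathbb{R}^d_{>0}$: for a $K$-vector space $W$ and $v(t)\in K((t))\otimes W$, $\operatorname{val}_t(v(t))$ is the largest integer $n$ with $v(t)\in t^n(K[[t]]\otimes W)$, and $\operatorname{val}_t(0)=\infty$. Let $\mathrm{GL}(U_i,K[[t]])$ be the set of elements of $K[[t]]\otimes\operatorname{End}(U_i)$ that are invertible over $K((t))$ (the inverse need not have entries in $K[[t]]$), and $G(K[[t]])=\prod_i\mathrm{GL}(U_i,K[[t]])$, acting on $K((t))\otimes U$ factorwise. Then $\operatorname{rk}^G_\alpha(u)$ is the infimum of $$\mu_\alpha(g(t),u)=\frac{\sum_{i=1}^d\alpha_i\operatorname{val}_t(\det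 g_i(t))}{\operatorname{val}_t(g(t)\cdot u)}$$ over all $g(t)=(g_1(t),\dots,g_d(t))\in G(K[[t]])$ with $\operatorname{val}_t(g(t)\cdot u)>0$ (a quotient with denominator $\infty$ is $0$). *)

(* Defs.v *)
From HB Require Import structures.
From mathcomp Require Import all_boot all_order all_algebra all_field.
From mathcomp Require Import all_classical all_reals ereal.

Set Implicit Arguments.
Unset Strict Implicit.
Unset Printing Implicit Defensive.

Import Order.TTheory GRing.Theory Num.Theory.

Local Open Scope ring_scope.

Definition perfect_field (K : fieldType) : Prop :=
  forall f : {poly K}, irreducible_poly f -> separable_poly f.

(* K[[t]]; the type is wrapped so that nat -> K keeps its pointwise ring
   structure apart. *)
Record fps (K : Type) := FPS { fpscoef : nat -> K }.

Lemma fpsP (K : Type) (f g : fps K) :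
  (forall n, fpscoef f n = fpscoef g n) -> f = g.
Proof. by case: f g => [f] [g] /= fg; congr FPS; apply/funext. Qed.

HB.instance Definition _ (K : Type) := gen_eqMixin (fps K).
HB.instance Definition _ (K : Type) := gen_choiceMixin (fps K).

Section FpsRing.
Variable K : fieldType.
Implicit Types f g h : fps K.

Definition fps_add f g : fps K := FPS (fun n => fpscoef f n + fpscoef g n).
Definition fps_opp f : fps K := FPS (fun n => - fpscoef f n).
Definition fps_mul f g : fps K :=
  FPS (fun n => \sum_(i < n.+1) fpscoef f i * fpscoef g (n - i)).
Definition fpsC (c : K) : fps K := FPS (fun n => if n == 0%N then c else 0).
Definition fpsX : fps K := FPS (fun n => (n == 1%N)%:R).

Lemma fps_addA : associative fps_add.
Proof. by move=> f g h; apply: fpsP => n /=; rewrite addrA. Qed.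
Lemma fps_addC : commutative fps_add.
Proof. by move=> f g; apply: fpsP => n /=; rewrite addrC. Qed.
Lemma fps_add0 : left_id (fpsC 0) fps_add.
Proof. by move=> f; apply: fpsP => n /=; rewrite if_same add0r. Qed.
Lemma fps_addN : left_inverse (fpsC 0) fps_opp fps_add.
Proof. by move=> f; apply: fpsP => n /=; rewrite if_same addNr. Qed.

HB.instance Definition _ :=
  GRing.isZmodule.Build (fps K) fps_addA fps_addC fps_add0 fps_addN.

Definition fps_trunc (N : nat) f : {poly K} := \poly_(i < N) fpscoef f i.

Lemma fps_mul_trunc N f g n : (n < N)%N ->
  fpscoef (fps_mul f g) n = (fps_trunc N f * fps_trunc N g)`_n.
Proof.
move=> nN; rewrite coefM /=; apply: eq_bigr => i _; rewrite !coef_poly.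
by rewrite (leq_trans (ltn_ord i) nN) (leq_ltn_trans (leq_subr _ _) nN).
Qed.

Lemma fps_mulA : associative fps_mul.
Proof.
move=> f g h; apply: fpsP => n; pose N := n.+1.
have tr a b k : (k <= n)%N ->
    (fps_trunc N (fps_mul a b))`_k = (fps_trunc N a * fps_trunc N b)`_k.
  by move=> kn; rewrite coef_poly ltnS kn; apply: fps_mul_trunc.
rewrite !(@fps_mul_trunc N) // coefM.
under eq_bigr => i _ do rewrite tr ?leq_subr //.
rewrite -coefM mulrA coefM [RHS]coefM; apply: eq_bigr => i _.
by rewrite tr // -ltnS.
Qed.

Lemma fps_mulC : commutative fps_mul.
Proof.
by move=> f g; apply: fpsP => n; rewrite !(@fps_mul_trunc n.+1) // mulrC.
Qed.

Lemma fps_mul1 : left_id (fpsC 1) fps_mul.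
Proof.
move=> f; apply: fpsP => n /=; rewrite big_ord_recl /= mul1r subn0.
by rewrite big1 ?addr0 // => i _; rewrite mul0r.
Qed.

Lemma fps_mulDl : left_distributive fps_mul fps_add.
Proof.
move=> f g h; apply: fpsP => n /=; rewrite -big_split /=.
by apply: eq_bigr => i _; rewrite mulrDl.
Qed.

Lemma fps_1neq0 : fpsC 1 != 0.
Proof.
apply/eqP => /(congr1 (fun f => fpscoef f 0)) /= /eqP.
by rewrite oner_eq0.
Qed.

HB.instance Definition _ := GRing.Zmodule_isComNzRing.Build (fps K)
  fps_mulA fps_mulC fps_mul1 fps_mulDl fps_1neq0.

Definition fps_unit : {pred fps K} := fun f => `[< exists g, g * f = 1 >].
Definition fps_inv f : fps K := xget f [set g | g * f = 1]%classic.

Lemma fps_mulV : {in fps_unit, left_inverse 1 fps_inv *%R}.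
Proof.
move=> f /asboolP[g gf1]; rewrite /fps_inv.
by case: xgetP => [h -> //|/(_ g) /(_ gf1)].
Qed.

Lemma fps_unitPl f g : g * f = 1 -> fps_unit f.
Proof. by move=> gf1; apply/asboolP; exists g. Qed.

Lemma fps_inv_out : {in [predC fps_unit], fps_inv =1 id}.
Proof.
move=> f nUf; rewrite /fps_inv; case: xgetP => [h _ hf1|//].
by case/negP: nUf; apply: fps_unitPl hf1.
Qed.

HB.instance Definition _ := GRing.ComNzRing_hasMulInverse.Build (fps K)
  fps_mulV fps_unitPl fps_inv_out.

Lemma fps_neq0 f : f != 0 ->
  exists2 n, fpscoef f n != 0 & forall k, (k < n)%N -> fpscoef f k = 0.
Proof.
move=> f0; have exf : exists n, fpscoef f n != 0.
  apply: contrapT => /forallNP nf; case/eqP: f0; apply: fpsP => n /=.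
  by rewrite if_same; apply/eqP/negPn/negP/nf.
case: (ex_minnP exf) => n fn0 minn; exists n => // k kn.
by apply/eqP/negPn/negP => /minn; rewrite leqNgt kn.
Qed.

Lemma fps_idomain : GRing.integral_domain_axiom (fps K).
Proof.
move=> f g fg0; apply/norP => -[/fps_neq0[a fa0 fa] /fps_neq0[b gb0 gb]].
have /= := congr1 (fun h => fpscoef h (a + b)) fg0.
have lta : (a < (a + b).+1)%N by rewrite ltnS leq_addr.
rewrite (bigD1 (Ordinal lta)) //= addKn big1 ?addr0 => [|i /eqP ia].
  by rewrite if_same => /eqP; rewrite mulf_eq0 (negPf fa0) (negPf gb0).
have [iLa|aLi] := ltnP i a; first by rewrite fa ?mul0r.
have {}aLi : (a < i)%N.
  by rewrite ltn_neqAle aLi andbT; apply/eqP => ai; apply: ia; apply/val_inj.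
by rewrite gb ?mulr0 // ltn_subLR ?ltn_add2r // -ltnS.
Qed.

HB.instance Definition _ :=
  GRing.ComUnitRing_isIntegral.Build (fps K) fps_idomain.

End FpsRing.

(* K((t)) is the fraction field of K[[t]]. *)
Definition laurent (K : fieldType) : fieldType := {fraction (fps K)}.

Notation fps_laurent := (@FracField.tofrac (fps _)).

Definition tvar (K : fieldType) : laurent K := fps_laurent (fpsX K).

Section Valuation.
Variables (K : fieldType) (I : finType).

(* With W = K^I, a vector of K((t)) (x) W is its family of coordinates. *)
Definition in_tpow (n : int) (v : {ffun I -> laurent K}) : Prop :=
  exists w : {ffun I -> fps K}, forall i, v i = tvar K ^ n * fps_laurent (w i).

(* The default 0 of xget is never used: the largest exponent exists when
   v != 0. *)
Definition valt (v : {ffun I -> laurent K}) : \bar int :=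
  if v == 0 then +oo%E
  else (xget 0 [set n : int | in_tpow n v /\
                  forall k : int, in_tpow k v -> k <= n]%classic)%:E.

End Valuation.

Definition valt1 (K : fieldType) (x : laurent K) : \bar int :=
  valt [ffun _ : unit => x].

Section GStableRank.
Variables (K : fieldType) (d : nat) (n : 'I_d -> nat).

(* Elements of F^(n 0) (x) ... (x) F^(n (d-1)), by their coordinates in the
   basis [j_0] (x) ... (x) [j_(d-1)]. *)
Definition multi_index : finType := {dffun forall i : 'I_d, 'I_(n i)}.
Definition tensor (F : Type) := {ffun multi_index -> F}.

Definition tensor_act (F : fieldType) (g : forall i : 'I_d, 'M[F]_(n i))
    (v : tensor F) : tensor F :=
  [ffun J : multi_index =>
     \sum_(L : multi_index) (\prod_(i < d) g i (J i) (L i)) * v L].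

Definition tensor_laurent (u : tensor K) : tensor (laurent K) :=
  [ffun J => fps_laurent (fpsC (u J))].

Definition mx_laurent k (g : 'M[fps K]_k) : 'M[laurent K]_k :=
  map_mx fps_laurent g.

(* Only invertibility over K((t)) is required. *)
Definition in_GL k (g : 'M[fps K]_k) : Prop := mx_laurent g \in unitmx.

Definition in_G (g : forall i : 'I_d, 'M[fps K]_(n i)) : Prop :=
  forall i, in_GL (g i).

Definition val_act (g : forall i : 'I_d, 'M[fps K]_(n i)) (u : tensor K) :
    \bar int :=
  valt (tensor_act (fun i => mx_laurent (g i)) (tensor_laurent u)).

Section Weight.
Variables (R : realType) (alpha : 'I_d -> R).

Definition ext_real (x : \bar int) : \bar R := er_map (fun k : int => k%:~R) x.

(* In \bar R, (+oo)^-1 = 0, so that the quotient is 0 when the denominator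
   is +oo. *)
Definition mu_stable (g : forall i : 'I_d, 'M[fps K]_(n i)) (u : tensor K) :
    \bar R :=
  ((\sum_(i < d) (alpha i)%:E * ext_real (valt1 (\det (mx_laurent (g i)))))
     / ext_real (val_act g u))%E.

Definition gstable_rank (u : tensor K) : \bar R :=
  ereal_inf [set mu_stable g u | g in
    [set g : forall i : 'I_d, 'M[fps K]_(n i) |
       in_G g /\ (0 < val_act g u)%E]]%classic.

End Weight.
End GStableRank.

Section NonCommutativeRank.
Variables (K : fieldType) (m p q : nat) (A : 'I_m -> 'M[K]_(p, q)).

(* Matrices act on column vectors; the truncated subtraction is exact since
   \dim W <= q. *)
Definition ncrk_value (W : {vspace 'cV[K]_q}) : nat :=
  (q + \dim (\sum_(i < m) (linfun (mulmx (A i)) @: W)) - \dim W)%N.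

Lemma ncrk_value_ex : exists r, `[< exists W, ncrk_value W = r >].
Proof. by exists (ncrk_value 0%VS); apply/asboolP; exists 0%VS. Qed.

Definition ncrk : nat := ex_minn ncrk_value_ex.

Definition tuple_dim : 'I_3 -> nat := fun i => nth 0%N [:: p; q; m] i.

(* T_A = \sum_i A_i (x) [i] in K^p (x) K^q (x) K^m: the coordinate of
   A_i (x) [i] on [a] (x) [b] (x) [c] is A_i a b times the c-th coordinate
   of [i]. *)
Definition tuple_tensor : tensor tuple_dim K :=
  [ffun J : multi_index tuple_dim =>
     let a : 'I_p := J (@Ordinal 3 0 isT) in
     let b : 'I_q := J (@Ordinal 3 1 isT) in
     let c : 'I_m := J (@Ordinal 3 2 isT) in
     \sum_(i < m) A i a b * (delta_mx 0 i : 'rV[K]_m) 0 c].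

End NonCommutativeRank.

(* Main.v *)
Require Import Defs.
From HB Require Import structures.
From mathcomp Require Import all_boot all_order all_algebra all_fingroup.
From mathcomp Require Import all_field zify.
From mathcomp Require Import all_classical all_reals ereal.

Set Implicit Arguments.
Unset Strict Implicit.
Unset Printing Implicit Defensive.

Import Order.TTheory GRing.Theory Num.Theory.
Local Open Scope ring_scope.

(** Write r for the non-commutative rank of A.

    The stable rank is at most r because an optimal subspace W gives a
    one-parameter degeneration: with V the sum of the A_i(W), choose bases of
    K^p and K^q adapted to V and W, multiply by t the coordinates along V and
    the coordinates off W.  In these bases a nonzero entry of A_i in a column
    of W lies in a row of V, so every entry of the tensor becomes divisible by t,
    and the determinants have valuations dim V and q - dim W, of sum r
    (exists_degeneration).

    For the converse, let g = (g_0, g_1, g_2) have determinants of valuations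
    d_0, d_1, d_2, and let t^s divide g.T_A.  Applying the adjugate of g_2 to
    the third factor replaces g_2 by its determinant, so t^(s - d_2) divides
    g_0 A_k g_1^T for every k (ncrk_le_act).  A Smith form
    g_i = L diag(t^a) M over K[[t]], with L and M invertible over K[[t]]
    (exists_smith), removes L without changing divisibility, and the constant
    terms of the two matrices M turn A into an equivalent tuple B over K whose
    (i, j) entries vanish when a_i + b_j < s - d_2 (ncrk_le_orders).  For each
    threshold theta < s - d_2 the columns with b_j <= theta span a subspace
    that B maps into the rows with a_i >= s - d_2 - theta; this bounds r by
    #{a_i >= s - d_2 - theta} + #{b_j > theta}, and summing over theta gives
    (s - d_2) r <= d_0 + d_1 (ncrk_weights).  As r <= min(p, q) <= l, the
    missing d_2 r is paid for by l d_2 (weight_leq), whence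
    s r <= d_0 + d_1 + l d_2. *)

(** * Divisibility by powers of t in K[[t]] *)

Section PowerSeries.
Variable K : fieldType.
Implicit Types (f g h : fps K) (n : nat).

Definition constcoef f : K := fpscoef f 0.

Lemma constcoef_zmod : zmod_morphism constcoef.
Proof. by []. Qed.

Lemma constcoef_monoid : monoid_morphism constcoef.
Proof. by split=> // f g; rewrite /constcoef /= big_ord1. Qed.

HB.instance Definition _ :=
  GRing.isZmodMorphism.Build (fps K) K constcoef constcoef_zmod.
HB.instance Definition _ :=
  GRing.isMonoidMorphism.Build (fps K) K constcoef constcoef_monoid.

Lemma fpsC_zmod : zmod_morphism (@fpsC K).
Proof. by move=> x y; apply: fpsP => -[|n] //=; rewrite subr0. Qed.

Lemma fpsC_monoid : monoid_morphism (@fpsC K).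
Proof.
split=> // x y; apply: fpsP => n /=; rewrite big_ord_recl /= subn0.
rewrite big1 ?addr0 => [|i _]; last by rewrite mul0r.
by case: n => //= n; rewrite mulr0.
Qed.

HB.instance Definition _ :=
  GRing.isZmodMorphism.Build K (fps K) (@fpsC K) fpsC_zmod.
HB.instance Definition _ :=
  GRing.isMonoidMorphism.Build K (fps K) (@fpsC K) fpsC_monoid.

Lemma constcoefC x : constcoef (fpsC x) = x.
Proof. by []. Qed.

Lemma coef_fpsXnM n f k :
  fpscoef (fpsX K ^+ n * f) k = if (k < n)%N then 0 else fpscoef f (k - n).
Proof.
elim: n f k => [|n IH] f k; first by rewrite mul1r subn0.
rewrite exprSr -mulrA IH ltnS.
have -> j : fpscoef (fpsX K * f) j = if j is j'.+1 then fpscoef f j' else 0.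
  case: j => [|j] /=; first by rewrite big_ord1 mul0r.
  rewrite 2!big_ord_recl /= mul0r add0r mul1r subn1 big1 ?addr0 // => i _.
  by rewrite mul0r.
case: ltngtP => [//|nk|->]; last by rewrite subnn.
by rewrite -[k in LHS](subnK nk) addnS subSn ?leq_addl ?addnK.
Qed.

Lemma fpsXn_neq0 n : fpsX K ^+ n != 0.
Proof.
rewrite expf_neq0 //; apply/eqP => /(congr1 (fun f => fpscoef f 1)) /= /eqP.
by rewrite oner_eq0.
Qed.

Definition tdvd n f := exists h, f = fpsX K ^+ n * h.

Lemma tdvdP n f : (forall k, (k < n)%N -> fpscoef f k = 0) -> tdvd n f.
Proof.
move=> fn; exists (FPS (fun k => fpscoef f (n + k))); apply: fpsP => k.
by rewrite coef_fpsXnM; case: ltnP => [/fn //|nk] /=; rewrite subnKC.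
Qed.

Lemma tdvd_coef n f k : tdvd n f -> (k < n)%N -> fpscoef f k = 0.
Proof. by move=> [h ->] kn; rewrite coef_fpsXnM kn. Qed.

Lemma tdvd0 n : tdvd n 0.
Proof. by exists 0; rewrite mulr0. Qed.

Lemma tdvdM a b f g : tdvd a f -> tdvd b g -> tdvd (a + b) (f * g).
Proof. by move=> [x ->] [y ->]; exists (x * y); rewrite exprD mulrACA. Qed.

Lemma tdvdMl n f g : tdvd n g -> tdvd n (f * g).
Proof. by move=> [x ->]; exists (f * x); rewrite mulrCA. Qed.

Lemma tdvdMr n f g : tdvd n g -> tdvd n (g * f).
Proof. by rewrite mulrC; apply: tdvdMl. Qed.

Lemma tdvd_sum n (I : finType) (P : pred I) (F : I -> fps K) :
  (forall i, P i -> tdvd n (F i)) -> tdvd n (\sum_(i | P i) F i).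
Proof.
move=> FP; elim/big_ind: _ => //; first exact: tdvd0.
by move=> _ _ [x ->] [y ->]; exists (x + y); rewrite mulrDr.
Qed.

Lemma tdvd_cancel d n f : tdvd n (fpsX K ^+ d * f) -> tdvd (n - d) f.
Proof.
move=> dv; apply: tdvdP => k; rewrite ltn_subRL => kn.
by have := tdvd_coef dv kn; rewrite coef_fpsXnM ltnNge leq_addr /= addKn.
Qed.

(** With x = 1 - f / f(0) divisible by t, the geometric series in x is an
    inverse of 1 - x; each of its coefficients is a finite sum, since t^k
    divides x^k. *)
Lemma fps_unitE f : (f \is a GRing.unit) = (constcoef f != 0).
Proof.
apply/idP/idP => [/(rmorph_unit constcoef)|f0]; first by rewrite unitfE.
pose x := 1 - fpsC (constcoef f)^-1 * f.
have dx k : tdvd k (x ^+ k).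
  elim: k => [|k IH]; first by exists 1; rewrite mulr1.
  rewrite exprS -add1n; apply: tdvdM IH; apply: tdvdP => -[] // _.
  rewrite -[LHS]/(constcoef _) rmorphB rmorph1 rmorphM.
  by rewrite [X in X * _]constcoefC mulVf ?subrr.
pose s n := \sum_(k < n) x ^+ k.
have cs n k : (k < n)%N -> fpscoef (s n) k = fpscoef (s k.+1) k.
  elim: n => // n IH; rewrite ltnS leq_eqVlt => /predU1P[->//|kn].
  rewrite -IH // /s big_ord_recr /= (tdvd_coef (dx n) kn); exact: addr0.
pose y : fps K := FPS (fun n => fpscoef (s n.+1) n).
have yx : (1 - x) * y = 1.
  apply: fpsP => n.
  transitivity (fpscoef ((1 - x) * s n.+1) n).
    by apply: eq_bigr => i _; rewrite [in RHS]cs // ltnS leq_subr.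
  rewrite /s -opprB mulNr -subrX1 opprB /=.
  by rewrite (tdvd_coef (dx n.+1)) // subr0.
have: (1 - x) \is a GRing.unit.
  by apply/unitrPr; exists y.
by rewrite opprB addrC subrK unitrM => /andP[].
Qed.

End PowerSeries.

(** * Smith form over K[[t]] *)

Section SmithForm.
Variable K : fieldType.
Implicit Types (f : fps K) (n : nat).

(** The order is a relation rather than a function, so that no value has to be
    chosen for f = 0. *)
Definition has_order n f := exists2 u, u \is a GRing.unit & f = fpsX K ^+ n * u.

Lemma exists_order f : f != 0 -> exists n, has_order n f.
Proof.
move=> /fps_neq0[n fn /tdvdP[u fE]]; exists n, u => //.
by rewrite fps_unitE; move: fn; rewrite fE coef_fpsXnM ltnn subnn.
Qed.

Lemma tdvd_order n d f : has_order d f -> tdvd n f -> (n <= d)%N.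
Proof.
move=> [u uu ->] nf; rewrite leqNgt; apply/negP => dn.
have := tdvd_coef nf dn; rewrite coef_fpsXnM ltnn subnn => u0.
by move: uu; rewrite fps_unitE /constcoef u0 eqxx.
Qed.

Definition smith n (g : 'M[fps K]_n) := exists U V (a : 'I_n -> nat),
  [/\ U \in unitmx, V \in unitmx &
      g = U *m diag_mx (\row_i (fpsX K ^+ a i)) *m V].

Lemma smithM n (U g V : 'M[fps K]_n) :
  U \in unitmx -> V \in unitmx -> smith g -> smith (U *m g *m V).
Proof.
move=> uU uV [U' [V' [a [uU' uV' ->]]]]; exists (U *m U'), (V' *m V), a.
by rewrite !unitmx_mul uU uV uU' uV' !mulmxA.
Qed.

Lemma smithZ n v (g : 'M[fps K]_n) : smith g -> smith (fpsX K ^+ v *: g).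
Proof.
move=> [U [V [a [uU uV ->]]]]; exists U, V, (fun i => v + a i)%N; split=> //.
rewrite scalemxAl scalemxAr -linearZ /=; congr (_ *m diag_mx _ *m _).
by apply/rowP=> i; rewrite !mxE exprD.
Qed.

Lemma smith_block n f (D : 'M[fps K]_n) : f \is a GRing.unit -> smith D ->
  smith (block_mx f%:M 0 0 D : 'M_(1 + n)).
Proof.
move=> uf [U [V [a [uU uV ->]]]].
exists (block_mx f%:M 0 0 U : 'M_(1 + n)), (block_mx 1%:M 0 0 V : 'M_(1 + n)).
exists (fun i : 'I_(1 + n) => if fintype.split i is inr j then a j else 0%N).
split; rewrite ?unitmxE ?det_ublock ?det_scalar1 ?unitrM ?uf ?det1 ?unitr1 //.
rewrite (_ : \row__ _ = row_mx 1%:M (\row_i (fpsX K ^+ a i))); last first.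
  apply/rowP=> i; rewrite !mxE; case: fintype.split => j; rewrite !mxE //.
  by rewrite ord1 eqxx.
rewrite diag_mx_row !mulmx_block !(mulmx0, mul0mx, addr0, add0r, mulmx1).
congr block_mx; rewrite (_ : diag_mx _ = 1%:M) ?mulmx1 //.
by apply/matrixP=> i j; rewrite !ord1 !mxE.
Qed.

(** Gaussian elimination over a discrete valuation ring: after factoring out
    the power of t common to all entries, some entry is a unit; moved to the
    corner, it clears its row and its column, and the induction proceeds on
    the Schur complement. *)
Lemma exists_smith n (g : 'M[fps K]_n) : \det g != 0 -> smith g.
Proof.
elim: n g => [|n IH] g dg.
  exists 1%:M, 1%:M, (fun=> 0%N); rewrite unitmx1.
  by split=> //; apply/matrixP=> -[].
pose P k := `[< exists ij, fpscoef (g ij.1 ij.2) k != 0 >].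
have exP : exists k, P k.
  have: g != 0 by apply: contraNneq dg => ->; rewrite det0.
  move=> g0; have /existsP[ij gij] : [exists ij, g ij.1 ij.2 != 0].
    apply: contraNT g0 => /existsPn g0; apply/eqP/matrixP => i j.
    by have /negPn/eqP/= -> := g0 (i, j); rewrite mxE.
  by have [k gk _] := fps_neq0 gij; exists k; apply/asboolP; exists ij.
case: (ex_minnP exP) => v /asboolP[[i0 j0] /= gv] vmin.
have gdvd i j : tdvd v (g i j).
  apply: tdvdP => k kv; apply/eqP; apply: contraTT kv => gk.
  by rewrite -leqNgt; apply: vmin; apply/asboolP; exists (i, j).
(* h is g / t^v; its (i0, j0) entry is a unit by minimality of v. *)
pose h : 'M_n.+1 :=
  \matrix_(i, j) xget 0 [set x | g i j = fpsX K ^+ v * x]%classic.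
have gh : g = fpsX K ^+ v *: h.
  apply/matrixP => i j; rewrite !mxE; case: xgetP => [//|].
  by have [x gx] := gdvd i j => /(_ x).
have uh : h i0 j0 \is a GRing.unit.
  by rewrite fps_unitE; move: gv; rewrite gh mxE coef_fpsXnM ltnn subnn.
have dh : \det h != 0.
  by apply: contraNneq dg => h0; rewrite gh detZ h0 mulr0.
rewrite gh; apply: smithZ.
pose S : 'M_(1 + n) := tperm_mx ord0 i0 *m h *m tperm_mx ord0 j0.
have hS : h = tperm_mx ord0 i0 *m S *m tperm_mx ord0 j0.
  rewrite /S /tperm_mx !mulmxA -perm_mxM tperm2 perm_mx1 mul1mx.
  by rewrite -mulmxA -perm_mxM tperm2 perm_mx1 mulmx1.
have uT i : (tperm_mx ord0 i : 'M[fps K]_n.+1) \in unitmx by exact: unitmx_perm.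
rewrite hS; apply: smithM => //.
have dS : \det S != 0.
  apply: contraNneq dh; rewrite hS !det_mulmx => ->.
  by rewrite mulr0 mul0r.
have uS : S ord0 ord0 \is a GRing.unit.
  rewrite /S -mulmxA -xrowE -xcolE; move: (h) uh => h' uh'.
  by rewrite !mxE !tpermL.
clear hS; clearbody S; rewrite -(submxK S) in dS *.
set c := ulsubmx S in dS *; set D := drsubmx S in dS *.
set x := ursubmx S in dS *; set y := dlsubmx S in dS *.
set f := S ord0 ord0 in uS.
have cE : c = f%:M.
  apply/matrixP => i j; rewrite !ord1 !mxE mulr1n /f.
  by congr (fun_of_matrix S _ _); apply: val_inj.
(* S = L diag(f, D - y f^-1 x) M with L and M unipotent. *)
pose L : 'M_(1 + n) := block_mx 1%:M 0 (f^-1 *: y) 1%:M.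
pose M : 'M_(1 + n) := block_mx 1%:M (f^-1 *: x) 0 1%:M.
have uL : L \in unitmx by rewrite unitmxE det_lblock !det1 mulr1 unitr1.
have uM : M \in unitmx by rewrite unitmxE det_ublock !det1 mulr1 unitr1.
have SE : block_mx c x y D =
    L *m block_mx f%:M 0 0 (D - f^-1 *: (y *m x)) *m M.
  rewrite !mulmx_block !(mulmx0, mul0mx, addr0, add0r, mulmx1, mul1mx) cE.
  rewrite !mul_scalar_mx -scalemxAl !mul_mx_scalar !scalerA.
  by rewrite divrr // mulVr // !scale1r -scalemxAr subrKC.
rewrite SE; apply: smithM => //; apply: smith_block => //; apply: IH.
apply: contraNneq dS => D0.
by rewrite SE !det_mulmx det_ublock D0 !(mulr0, mul0r).
Qed.

End SmithForm.

(** * Bounds on the non-commutative rank from vanishing entries *)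

Section ZeroBlock.
Variables (K : fieldType) (m p q : nat) (A : 'I_m -> 'M[K]_(p, q)).

Lemma ncrk_le W : (ncrk A <= ncrk_value A W)%N.
Proof.
rewrite /ncrk; case: ex_minnP => r _; apply.
by apply/asboolP; exists W.
Qed.

Lemma ncrk_attained : exists W, ncrk_value A W = ncrk A.
Proof. by rewrite /ncrk; case: ex_minnP => r /asboolP. Qed.

Lemma dim_cVn n : \dim {: 'cV[K]_n} = n.
Proof. by rewrite dimvf /dim /= muln1. Qed.

Lemma ncrk_leq_minn : (ncrk A <= minn p q)%N.
Proof.
rewrite leq_min; apply/andP; split.
  apply: leq_trans (ncrk_le fullv) _; rewrite /ncrk_value dim_cVn addKn.
  by apply: leq_trans (dimvS (subvf _)) _; rewrite dim_cVn.
apply: leq_trans (ncrk_le 0%VS) _; rewrite /ncrk_value.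
rewrite dimv0 subn0 big1 ?dimv0 ?addn0 // => i _; exact: limg0.
Qed.

(** The witness W is spanned by the columns of V2 outside Q: each A_k sends it
    into the span of the columns of V1^-1 in P, while the columns in Q span
    a complement of W. *)
Lemma ncrk_zero_block (V1 : 'M_p) (V2 : 'M_q) (P : pred 'I_p) (Q : pred 'I_q) :
    V1 \in unitmx -> V2 \in unitmx ->
    (forall k i j, ~~ P i -> ~~ Q j -> (V1 *m A k *m V2) i j = 0) ->
  (ncrk A <= #|P| + #|Q|)%N.
Proof.
move=> uV1 uV2 B0.
pose e j : 'cV[K]_q := V2 *m delta_mx j 0.
pose W := <<[seq e j | j <- enum (predC Q)]>>%VS.
pose W' := <<[seq e j | j <- enum Q]>>%VS.
pose f i : 'cV[K]_p := invmx V1 *m delta_mx i 0.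
pose X := <<[seq f i | i <- enum P]>>%VS.
have dX : (\dim X <= #|P|)%N.
  by apply: leq_trans (dim_span _) _; rewrite size_map cardE.
have dW' : (\dim W' <= #|Q|)%N.
  by apply: leq_trans (dim_span _) _; rewrite size_map cardE.
(* W + W' is everything, which avoids computing dim W exactly. *)
have dW : (q <= \dim W + #|Q|)%N.
  rewrite -{1}(dim_cVn q); apply: leq_trans (leq_add (leqnn _) dW').
  apply: leq_trans (dimv_add_leqif _ _); apply: dimvS; apply/subvP=> v _.
  rewrite -(mulKVmx uV2 v) [invmx V2 *m v]matrix_sum_delta.
  rewrite mulmx_sumr memv_suml // => j _; rewrite big_ord1 -scalemxAr.
  rewrite memvZ //; have [Qj|nQj] := boolP (Q j).
    apply: subvP (addvSr _ _) _ _; apply/memv_span/(map_f e).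
    by rewrite mem_enum.
  apply: subvP (addvSl _ _) _ _; apply/memv_span/(map_f e).
  by rewrite mem_enum.
have AW : (\sum_(i < m) linfun (mulmx (A i)) @: W <= X)%VS.
  apply/subv_sumP => k _; rewrite limg_span; apply/span_subvP => x.
  move=> /mapP[y /mapP[j]]; rewrite mem_enum => nQj -> ->; rewrite lfunE /=.
  pose b := V1 *m A k *m V2 *m delta_mx j 0 : 'cV[K]_p.
  have -> : A k *m e j = invmx V1 *m b by rewrite /e /b -!mulmxA mulKmx.
  have bE i : b i 0 = (V1 *m A k *m V2) i j.
    by rewrite /b -colE mxE.
  rewrite [b]matrix_sum_delta mulmx_sumr memv_suml // => i _.
  rewrite big_ord1 bE -scalemxAr; have [Pi|nPi] := boolP (P i).
    by apply/memvZ/memv_span/(map_f f); rewrite mem_enum.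
  by rewrite B0 // scale0r mem0v.
apply: leq_trans (ncrk_le W) _; rewrite /ncrk_value leq_subLR.
rewrite addnC addnCA; apply: leq_add dW.
exact: leq_trans (dimvS AW) dX.
Qed.

Lemma sum_threshold s b : (\sum_(theta < s) (theta < b : nat) = minn s b)%N.
Proof.
elim: s => [|s IH]; first by rewrite big_ord0 min0n.
by rewrite big_ord_recr /= IH; lia.
Qed.

(** Each threshold theta < s makes the block of rows with a_i < s - theta and
    columns with b_j <= theta vanish, hence bounds the rank; the sum of these s
    bounds counts every row at most a_i times and every column at most b_j
    times. *)
Lemma ncrk_weights (V1 : 'M_p) (V2 : 'M_q)
    (a : 'I_p -> nat) (b : 'I_q -> nat) s :
    V1 \in unitmx -> V2 \in unitmx ->
    (forall k i j, (a i + b j < s)%N -> (V1 *m A k *m V2) i j = 0) ->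
  (s * ncrk A <= \sum_i a i + \sum_j b j)%N.
Proof.
move=> uV1 uV2 B0.
(* rev_ord theta is s - 1 - theta, so its being below a_i means
   s - theta <= a_i. *)
have le_theta (theta : 'I_s) :
    (ncrk A <= \sum_i (rev_ord theta < a i : nat) +
               \sum_j (theta < b j : nat))%N.
  have cardE n (P : pred 'I_n) : (\sum_i (P i : nat) = #|P|)%N.
    rewrite -sum1_card [RHS]big_mkcond; apply: eq_bigr => i _.
    by rewrite unfold_in; case: (P i).
  rewrite (cardE _ (fun i => rev_ord theta < a i)%N).
  rewrite (cardE _ (fun j => theta < b j)%N).
  apply: ncrk_zero_block uV1 uV2 _.
  move=> k i j; rewrite -!leqNgt /= => ai bj; apply: B0.
  by have := ltn_ord theta; lia.
rewrite -[s in leqLHS]card_ord -sum_nat_const.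
apply: leq_trans (leq_sum _ (fun theta _ => le_theta theta)) _.
rewrite big_split /= exchange_big /= [X in (_ + X)%N]exchange_big /=.
apply: leq_add; apply: leq_sum => i _; last by rewrite sum_threshold geq_minr.
rewrite (reindex_inj rev_ord_inj) /=.
rewrite (eq_bigr (fun t : 'I_s => (t < a i : nat)%N)) => [|t _].
  by rewrite sum_threshold geq_minr.
by have -> : (s - (s - t.+1).+1 = t)%N by have := ltn_ord t; lia.
Qed.

(** Reduction to constant coefficients.  If g1 = U1 diag(t^a) V1 and
    g2 = U2 diag(t^b) V2, then t^s divides t^(a_i + b_j) times the (i, j) entry
    of V1 (A k) V2^T, so that the constant term of this entry vanishes as soon
    as a_i + b_j < s. *)
Lemma ncrk_le_orders (g1 : 'M[fps K]_p) (g2 : 'M[fps K]_q) d1 d2 s :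
    has_order d1 (\det g1) -> has_order d2 (\det g2) ->
    (forall k i j, tdvd s ((g1 *m map_mx (@fpsC K) (A k) *m g2^T) i j)) ->
  (s * ncrk A <= d1 + d2)%N.
Proof.
have det_neq0 n d (g : 'M[fps K]_n) : has_order d (\det g) -> \det g != 0.
  case=> u uu ->; rewrite mulf_neq0 ?fpsXn_neq0 //.
  by apply: contraTneq uu => ->; rewrite unitr0.
have sum_le n d (U V : 'M[fps K]_n) a :
    has_order d (\det (U *m diag_mx (\row_i (fpsX K ^+ a i)) *m V)) ->
  (\sum_i a i <= d)%N.
  move=> /tdvd_order; apply; exists (\det U * \det V).
  rewrite !det_mulmx det_diag mulrAC mulrC; congr (_ * _).
  rewrite expr_sum; by apply: eq_bigr => i _; rewrite mxE.
move=> o1 o2 dvd_s.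
have [U1 [V1 [a [uU1 uV1 E1]]]] := exists_smith (det_neq0 _ _ _ o1).
have [U2 [V2 [b [uU2 uV2 E2]]]] := exists_smith (det_neq0 _ _ _ o2).
rewrite E1 in o1; rewrite E2 in o2.
apply: leq_trans (leq_add (sum_le _ _ _ _ _ o1) (sum_le _ _ _ _ _ o2)).
pose c n (M : 'M[fps K]_n) := map_mx (@constcoef K) M.
have uc n (M : 'M[fps K]_n) : M \in unitmx -> c _ M \in unitmx.
  by rewrite !unitmxE det_map_mx; apply: rmorph_unit.
apply: (@ncrk_weights (c _ V1) (c _ V2^T)); rewrite ?uc ?unitmx_tr //.
move=> k i j ab.
pose Y := V1 *m map_mx (@fpsC K) (A k) *m V2^T.
have -> : c _ V1 *m A k *m c _ V2^T = map_mx (@constcoef K) Y.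
  rewrite !map_mxM; congr (_ *m _ *m _).
  by apply/matrixP=> x y; rewrite !mxE.
rewrite mxE; apply: (@tdvd_coef _ (s - (a i + b j))); last by rewrite subn_gt0.
apply: tdvd_cancel.
have -> : fpsX K ^+ (a i + b j) * Y i j =
   (invmx U1 *m (g1 *m map_mx (@fpsC K) (A k) *m g2^T) *m invmx U2^T) i j.
  rewrite E1 E2 !trmx_mul tr_diag_mx !mulmxA mulVmx // mul1mx.
  rewrite -!mulmxA mulmxV ?unitmx_tr // mulmx1 !mulmxA.
  rewrite -2!(mulmxA (diag_mx _)) -/Y mul_diag_mx mul_mx_diag !mxE.
  by rewrite exprD mulrAC.
rewrite mxE; apply: tdvd_sum => y _; apply: tdvdMr.
by rewrite mxE; apply: tdvd_sum => x _; apply: tdvdMl.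
Qed.

End ZeroBlock.

(** * Valuations of vectors with coordinates in K[[t]] *)

Section LaurentValuation.
Variables (K : fieldType) (I : finType).
Implicit Types (w : {ffun I -> fps K}) (n : nat).

Definition laurent_ffun w : {ffun I -> laurent K} :=
  [ffun i => fps_laurent (w i)].

Lemma tvarXn n : tvar K ^ n = fps_laurent (fpsX K ^+ n).
Proof. by rewrite -exprnP /tvar rmorphXn. Qed.

Lemma tofrac_inj : injective (fps_laurent : fps K -> laurent K).
Proof. by move=> x y /eqP; rewrite tofrac_eq => /eqP. Qed.

Lemma laurent_ffun_eq0 w : (laurent_ffun w == 0) = (w == 0).
Proof.
apply/eqP/eqP => [w0|->]; apply/ffunP => i; last first.
  by rewrite !ffunE rmorph0.
have /ffunP/(_ i) := w0.
by rewrite !ffunE -(rmorph0 fps_laurent) => /tofrac_inj.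
Qed.

(** The valuation of a vector over K[[t]] can be computed inside K[[t]]: a
    larger exponent k would be a natural number, and t^k would divide all
    coordinates. *)
Lemma valt_order w n : (forall i, tdvd n (w i)) ->
  (exists i, fpscoef (w i) n != 0) -> valt (laurent_ffun w) = (n : int)%:E.
Proof.
move=> wn [i0 wi0]; rewrite /valt laurent_ffun_eq0.
have [w0|_] := eqVneq w 0.
  by case/eqP: wi0; rewrite w0 ffunE /= if_same.
congr EFin; have maxn k : in_tpow k (laurent_ffun w) -> k <= n :> int.
  case=> w' ww'; rewrite leNgt; apply/negP => nk; case/eqP: wi0.
  case: k => [k|k] in ww' nk *; last by [].
  have := ww' i0; rewrite ffunE tvarXn -rmorphM => /tofrac_inj ->.
  by rewrite coef_fpsXnM -ltz_nat nk.
have inn : in_tpow n (laurent_ffun w).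
  pose h i := xget 0 [set x | w i = fpsX K ^+ n * x]%classic.
  exists [ffun i => h i] => i; rewrite !ffunE tvarXn -rmorphM.
  congr fps_laurent.
  by rewrite /h; case: xgetP => [//|]; have [x wx] := wn i => /(_ x).
case: xgetP => [x _ [xw xmax]|/(_ n)]; last by case.
by apply/eqP; rewrite eq_le maxn // xmax.
Qed.

Lemma exists_valt w : w != 0 ->
  exists n, [/\ valt (laurent_ffun w) = (n : int)%:E, forall i, tdvd n (w i) &
    forall k, (forall i, tdvd k (w i)) -> (k <= n)%N].
Proof.
move=> w0; pose P k := `[< exists i, fpscoef (w i) k != 0 >].
have exP : exists k, P k.
  have /existsP[i wi] : [exists i, w i != 0].
    apply: contraNT w0 => /existsPn w0; apply/eqP/ffunP => i.
    by have /negPn/eqP -> := w0 i; rewrite ffunE.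
  by have [k gk _] := fps_neq0 wi; exists k; apply/asboolP; exists i.
case: (ex_minnP exP) => n /asboolP wn nmin; exists n.
suff dvdw i : tdvd n (w i).
  split=> // [|k dvdk]; first exact: valt_order.
  have [i wi] := wn; rewrite leqNgt; apply: contra wi => nk.
  by rewrite (tdvd_coef (dvdk i) nk).
apply: tdvdP => k kn; apply/eqP; apply: contraTT kn => wk.
by rewrite -leqNgt; apply: nmin; apply/asboolP; exists i.
Qed.

End LaurentValuation.

Lemma valt1_order (K : fieldType) (f : fps K) d :
  has_order d f -> valt1 (fps_laurent f) = (d : int)%:E.
Proof.
move=> [u uu fE]; rewrite /valt1.
have -> : [ffun=> fps_laurent f] = laurent_ffun [ffun _ : unit => f].
  by apply/ffunP => i; rewrite !ffunE.
apply: valt_order => [i|]; first by exists u; rewrite ffunE.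
exists tt; rewrite ffunE fE coef_fpsXnM ltnn subnn.
by rewrite fps_unitE in uu.
Qed.

(** * The action on tensors of order three *)

Section Triples.

Definition o0 : 'I_3 := @Ordinal 3 0 isT.
Definition o1 : 'I_3 := @Ordinal 3 1 isT.
Definition o2 : 'I_3 := @Ordinal 3 2 isT.

(** The family is indexed by natural numbers, not by 'I_3, so that the proof
    component of the index does not appear in its type. *)
Definition triple (T : nat -> Type) (x0 : T 0%N) (x1 : T 1%N) (x2 : T 2%N)
    (i : 'I_3) : T i :=
  let: Ordinal k k3 := i in
  match k return (k < 3)%N -> T k with
  | 0 => fun=> x0
  | 1 => fun=> x1
  | 2 => fun=> x2
  | k'.+3 => fun k3' => False_rect _ (notF k3')
  end k3.

Lemma ord3_ind (P : 'I_3 -> Prop) : P o0 -> P o1 -> P o2 -> forall i, P i.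
Proof.
move=> P0 P1 P2 [[|[|[|k]]] k3] //.
- by rewrite (bool_irrelevance k3 isT).
- by rewrite (bool_irrelevance k3 isT).
- by rewrite (bool_irrelevance k3 isT).
Qed.

Lemma big_ord3 (R : Type) (idx : R) (op : Monoid.law idx) (F : 'I_3 -> R) :
  \big[op/idx]_(i < 3) F i = op (op (F o0) (F o1)) (F o2).
Proof.
rewrite !big_ord_recr big_ord0 /= Monoid.mul1m.
by congr (op (op (F _) (F _)) (F _)); apply: val_inj.
Qed.

End Triples.

Section TensorAction.

(** The action computed with power series, before embedding in Laurent
    series. *)
Definition fps_act (K : fieldType) d (n : 'I_d -> nat)
    (g : forall i, 'M[fps K]_(n i)) (u : tensor n K) : tensor n (fps K) :=
  [ffun J : multi_index n =>
     \sum_(L : multi_index n) (\prod_(i < d) g i (J i) (L i)) * fpsC (u L)].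

Lemma val_act_fps (K : fieldType) d (n : 'I_d -> nat)
    (g : forall i, 'M[fps K]_(n i)) (u : tensor n K) :
  val_act g u = valt (laurent_ffun (fps_act g u)).
Proof.
congr valt; apply/ffunP => J; rewrite !ffunE rmorph_sum.
apply: eq_bigr => L _; rewrite rmorphM rmorph_prod ffunE.
by congr (_ * _); apply: eq_bigr => i _; rewrite mxE.
Qed.

Variables (K : fieldType) (m p q : nat) (A : 'I_m -> 'M[K]_(p, q)).

Definition mindex (a : 'I_p) (b : 'I_q) (c : 'I_m) :
    multi_index (tuple_dim m p q) :=
  [ffun i => @triple (fun k => 'I_(nth 0%N [:: p; q; m] k)) a b c i].

Lemma mindex0 a b c : mindex a b c o0 = a. Proof. by rewrite ffunE. Qed.
Lemma mindex1 a b c : mindex a b c o1 = b. Proof. by rewrite ffunE. Qed.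
Lemma mindex2 a b c : mindex a b c o2 = c. Proof. by rewrite ffunE. Qed.

Lemma mindexK (J : multi_index (tuple_dim m p q)) :
  mindex (J o0) (J o1) (J o2) = J.
Proof. by apply/ffunP; apply: ord3_ind; rewrite ffunE. Qed.

Lemma big_mindex (V : nmodType) (F : multi_index (tuple_dim m p q) -> V) :
  \sum_L F L = \sum_a \sum_b \sum_c F (mindex a b c).
Proof.
rewrite pair_bigA pair_bigA /=.
rewrite (reindex (fun x : 'I_p * 'I_q * 'I_m => mindex x.1.1 x.1.2 x.2)) //=.
exists (fun J : multi_index (tuple_dim m p q) =>
    (J o0 : 'I_p, J o1 : 'I_q, J o2 : 'I_m)).
  by move=> [[a b] c] _ /=; rewrite mindex0 mindex1 mindex2.
by move=> J _; rewrite /= mindexK.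
Qed.

Lemma tuple_tensorE a b c : tuple_tensor A (mindex a b c) = A c a b.
Proof.
rewrite ffunE; cbv zeta; rewrite -/o0 -/o1 -/o2 mindex0 mindex1 mindex2.
rewrite (bigD1 c) //= mxE !eqxx mulr1.
rewrite big1 ?addr0 // => k kc; rewrite mxE eqxx /=.
by rewrite eq_sym (negPf kc) mulr0.
Qed.

(** On the slices of the tensor, the first two factors act by
    A_k -> g_0 A_k g_1^T and the third mixes the slices. *)
Lemma fps_act_tuple (g : forall i, 'M[fps K]_(tuple_dim m p q i)) J :
  fps_act g (tuple_tensor A) J =
  \sum_k (g o2 : 'M_m) (J o2) k *
    ((g o0 : 'M_p) *m map_mx (@fpsC K) (A k) *m (g o1 : 'M_q)^T) (J o0) (J o1).
Proof.
rewrite ffunE big_mindex.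
transitivity (\sum_(a < p) \sum_(b < q) \sum_(c < m)
    (g o2 : 'M_m) (J o2) c *
      ((g o0 : 'M_p) (J o0) a * fpsC (A c a b) * (g o1 : 'M_q) (J o1) b)).
  apply: eq_bigr => a _; apply: eq_bigr => b _; apply: eq_bigr => c _.
  rewrite tuple_tensorE big_ord3 mindex0 mindex1 mindex2 /=.
  by rewrite mulrAC mulrC; congr (_ * _); apply: mulrAC.
under eq_bigr do rewrite exchange_big; rewrite exchange_big /=.
apply: eq_bigr => k _; rewrite mxE mulr_sumr exchange_big /=.
apply: eq_bigr => b _; rewrite -mulr_sumr mxE mulr_suml; congr (_ * _).
by apply: eq_bigr => a _; rewrite !mxE.
Qed.

End TensorAction.

(** * The lower bound for one group element *)

Section Bounds.
Variables (K : fieldType) (m p q : nat) (A : 'I_m -> 'M[K]_(p, q)).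
Local Notation n3 := (tuple_dim m p q).

(** The identity adj(g_2) g_2 = det(g_2) isolates each slice at the cost of
    the factor t^d2.  The truncated subtraction makes the conclusion trivial
    when s <= d2. *)
Lemma ncrk_le_act (g : forall i, 'M[fps K]_(n3 i)) d0 d1 d2 s :
    has_order d0 (\det (g o0)) -> has_order d1 (\det (g o1)) ->
    has_order d2 (\det (g o2)) ->
    (forall J, tdvd s (fps_act g (tuple_tensor A) J)) ->
  ((s - d2) * ncrk A <= d0 + d1)%N.
Proof.
move=> og0 og1 [u uu g2E] dvd_s; apply: ncrk_le_orders og0 og1 _ => k a b.
pose Y k := ((g o0 : 'M_p) *m map_mx (@fpsC K) (A k) *m (g o1 : 'M_q)^T) a b.
have dvd_c c : tdvd s (\sum_k (g o2 : 'M_m) c k * Y k).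
  have := dvd_s (mindex a b c).
  by rewrite fps_act_tuple mindex0 mindex1 mindex2.
apply: tdvd_cancel; rewrite -/(Y k).
have -> : fpsX K ^+ d2 * Y k =
    u^-1 * \sum_c \adj (g o2 : 'M_m) k c * \sum_k' (g o2 : 'M_m) c k' * Y k'.
  transitivity (u^-1 * (\det (g o2 : 'M_m) * Y k)).
    by rewrite g2E !mulrA [u^-1 * _]mulrC mulrVK.
  congr (_ * _); under [RHS]eq_bigr do rewrite mulr_sumr.
  rewrite exchange_big /= (bigD1 k) //= [X in _ + X]big1 ?addr0 => [|k' k'k].
    under eq_bigr do rewrite mulrA; rewrite -mulr_suml; congr (_ * _).
    have /matrixP/(_ k k) := mul_adj_mx (g o2 : 'M_m).
    by rewrite !mxE eqxx => ->.
  under eq_bigr do rewrite mulrA; rewrite -mulr_suml.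
  have /matrixP/(_ k k') := mul_adj_mx (g o2 : 'M_m).
  by rewrite !mxE eq_sym (negPf k'k) => ->; rewrite mul0r.
by apply: tdvdMl; apply: tdvd_sum => c _; apply: tdvdMl.
Qed.

Lemma span_coords (vT : vectType K) (s : seq vT) v : v \in <<s>>%VS ->
  exists2 c : nat -> K, v = \sum_(j < size s) c j *: s`_j &
    forall j, (size s <= j)%N -> c j = 0.
Proof.
move=> /(coord_span (X := in_tuple s)) vE.
exists (fun j => if insub j is Some i then coord (in_tuple s) i v else 0).
  by rewrite {1}vE; apply: eq_bigr => i _; rewrite valK.
by move=> j sj; rewrite insubF // ltnNge sj.
Qed.

(** P is the matrix whose columns are a basis of V followed by a basis of a
    complement of V. *)
Lemma adapted_basis n (V : {vspace 'cV[K]_n}) : exists P : 'M[K]_n,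
  [/\ P \in unitmx, forall j : 'I_n, (j < \dim V)%N -> col j P \in V &
   forall v (i : 'I_n), v \in V -> (\dim V <= i)%N -> (invmx P *m v) i 0 = 0].
Proof.
pose X := vbasis V ++ vbasis V^C.
have sX : size X = n.
  rewrite size_cat !size_tuple dimv_compl subnKC ?dim_cVn //.
  by rewrite -[leqRHS](dim_cVn K) dimvS ?subvf.
pose P := \matrix_(i, j) X`_j i 0 : 'M[K]_n.
have colP (j : 'I_n) : col j P = X`_j.
  by apply/matrixP=> i k; rewrite !mxE ord1.
have PE (c : 'cV[K]_n) : P *m c = \sum_(j < n) c j 0 *: X`_j.
  apply/matrixP=> i k; rewrite ord1 mxE summxE; apply: eq_bigr => j _.
  by rewrite !mxE mulrC.
have inV v : v \in V -> exists2 c : 'cV[K]_n, v = P *m c &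
    forall i : 'I_n, (\dim V <= i)%N -> c i 0 = 0.
  rewrite -{1}(span_basis (vbasisP V)) => /span_coords[c vE c0].
  rewrite size_tuple in vE c0; exists (\col_i c i) => [|i Vi]; last first.
    by rewrite mxE c0.
  rewrite PE vE (big_ord_widen n (fun j => c j *: (vbasis V)`_j)); last first.
    by rewrite -[leqRHS](dim_cVn K) dimvS ?subvf.
  rewrite big_mkcond; apply: eq_bigr => j _; rewrite mxE nth_cat size_tuple.
  by case: ltnP => // Vj; rewrite c0 // scale0r.
have uP : P \in unitmx.
  have /(_ _)/cid2 H (j : 'I_n) :
      exists2 c : 'cV[K]_n, delta_mx j 0 = P *m c & True.
    have : (delta_mx j 0 : 'cV[K]_n) \in <<X>>%VS.
      rewrite span_cat !(span_basis (vbasisP _)) addv_complf; exact: memvf.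
    case/span_coords=> c cE _; exists (\col_i c i) => //.
    by rewrite cE sX PE; apply: eq_bigr => i _; rewrite mxE.
  pose Q := \matrix_(i, j) (s2val (H j)) i 0.
  have PQ : P *m Q = 1%:M.
    apply/matrixP=> i j; have /matrixP/(_ i 0) := s2valP (H j).
    rewrite mxE andbT => E; rewrite mxE; transitivity ((i == j)%:R : K) => //.
      by rewrite E mxE; apply: eq_bigr => k _; rewrite [Q k j]mxE.
    by rewrite mxE.
  by have [] := mulmx1_unit PQ.
exists P; split=> // [j jV|v i vV Vi].
  by rewrite colP nth_cat size_tuple jV vbasis_mem // mem_nth // size_tuple.
by have [c -> c0] := inV v vV; rewrite mulKmx // c0.
Qed.

End Bounds.

(** * A degeneration that attains the rank *)

Section Degeneration.
Variables (K : fieldType) (m p q : nat) (A : 'I_m -> 'M[K]_(p, q)).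
Local Notation n3 := (tuple_dim m p q).

Lemma order_diag n (a : 'I_n -> nat) (E : 'M[K]_n) : E \in unitmx ->
  has_order (\sum_i a i)
    (\det (diag_mx (\row_i (fpsX K ^+ a i)) *m map_mx (@fpsC K) E)).
Proof.
move=> uE; exists (\det (map_mx (@fpsC K) E)).
  by rewrite det_map_mx rmorph_unit // -unitmxE.
rewrite det_mulmx det_diag expr_sum; congr (_ * _).
by apply: eq_bigr => i _; rewrite mxE.
Qed.

(** Over adapted bases P of V = sum A_i(W) and Q of W, the (i, j) entry of
    P^-1 A_k Q vanishes when j < dim W and dim V <= i; every other entry is
    multiplied by t at least once. *)
Lemma exists_degeneration : exists (g : forall i, 'M[fps K]_(n3 i)) d0 d1,
  [/\ has_order d0 (\det (g o0)), has_order d1 (\det (g o1)),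
      has_order 0 (\det (g o2)), (d0 + d1)%N = ncrk A &
      forall J, tdvd 1 (fps_act g (tuple_tensor A) J)].
Proof.
have [W Wr] := ncrk_attained A.
pose V := (\sum_(i < m) linfun (mulmx (A i)) @: W)%VS.
have [P [uP _ PV]] := adapted_basis V.
have [Q [uQ QW _]] := adapted_basis W.
pose a (i : 'I_p) : nat := (i < \dim V)%N.
pose b (j : 'I_q) : nat := (\dim W <= j)%N.
pose g0 : 'M[fps K]_p :=
  diag_mx (\row_i (fpsX K ^+ a i)) *m map_mx (@fpsC K) (invmx P).
pose g1 : 'M[fps K]_q :=
  diag_mx (\row_i (fpsX K ^+ b i)) *m map_mx (@fpsC K) Q^T.
exists (@triple (fun k => 'M[fps K]_(nth 0%N [:: p; q; m] k)) g0 g1 1%:M).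
exists (\sum_i a i)%N, (\sum_j b j)%N.
have dV : (\dim V <= p)%N by rewrite -[leqRHS](dim_cVn K) dimvS ?subvf.
have dW : (\dim W <= q)%N by rewrite -[leqRHS](dim_cVn K) dimvS ?subvf.
split.
- by apply: order_diag; rewrite unitmx_inv.
- by apply: order_diag; rewrite unitmx_tr.
- by exists 1; rewrite ?unitr1 // det1 mulr1.
- rewrite /a sum_threshold (minn_idPr dV) -Wr /ncrk_value -/V.
  suff : (\sum_j b j + \dim W = q)%N by lia.
  rewrite -{1}(minn_idPr dW) -sum_threshold -big_split /=.
  rewrite -[RHS]card_ord -sum1_card.
  by apply: eq_bigr => j _; rewrite /b; case: ltnP.
move=> J; rewrite fps_act_tuple; apply: tdvd_sum => k _; apply: tdvdMl.
move: (J o0 : 'I_p) (J o1 : 'I_q) => i j.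
have -> : (g0 *m map_mx (@fpsC K) (A k) *m g1^T) i j =
    fpsX K ^+ a i * fpsX K ^+ b j * fpsC ((invmx P *m A k *m Q) i j).
  rewrite trmx_mul tr_diag_mx -map_trmx trmxK !mulmxA mul_mx_diag mxE.
  rewrite -!mulmxA mul_diag_mx mxE -!map_mxM mulmxA.
  move: (invmx P *m A k *m Q) => M.
  by rewrite !mxE mulrAC.
rewrite -exprD; have [ab|] := posnP (a i + b j); last first.
  case: (_ + _)%N => // e _; apply: tdvdMr.
  by exists (fpsX K ^+ e); rewrite exprS.
have [Vi jW] : (\dim V <= i)%N /\ (j < \dim W)%N.
  by move: ab; rewrite /a /b; case: ltnP => //; case: ltnP.
have -> : (invmx P *m A k *m Q) i j = (invmx P *m (A k *m col j Q)) i 0.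
  by rewrite colE !mulmxA -colE [RHS]mxE.
rewrite PV // ?rmorph0 ?mulr0; first exact: tdvd0.
apply: subvP (sumv_sup k _ (subvv _)) _ _ => //.
by apply/memv_imgP; exists (col j Q); rewrite ?QW // lfunE.
Qed.

End Degeneration.

(** * The equality of ranks *)

Lemma mu_numerator (R : realType) (K : fieldType) (m p q : nat) (l : R)
    (g : forall i, 'M[fps K]_(tuple_dim m p q i)) d0 d1 d2 :
    has_order d0 (\det (g o0)) -> has_order d1 (\det (g o1)) ->
    has_order d2 (\det (g o2)) ->
  (\sum_(i < 3) (tnth [tuple (1 : R); 1; l] i)%:E *
     ext_real R (valt1 (\det (mx_laurent (g i)))) =
   ((d0 + d1)%:R + l * d2%:R)%:E)%E.
Proof.
move=> og0 og1 og2; rewrite big_ord3 /mx_laurent !det_map_mx.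
rewrite (valt1_order og0) (valt1_order og1) (valt1_order og2).
by rewrite !(tnth_nth 0) /= !mul1e -!EFinM -!EFinD natrD.
Qed.

(** s r <= (s - d2) r + d2 r, where the first term is bounded by d0 + d1 and
    the second by l d2. *)
Lemma weight_leq (R : realType) (r s d0 d1 d2 : nat) (l : R) :
  r%:R <= l -> ((s - d2) * r <= d0 + d1)%N ->
  r%:R * s%:R <= (d0 + d1)%:R + l * d2%:R :> R.
Proof.
move=> rl srd; apply: (@le_trans _ _ ((s - d2) * r + r * d2)%N%:R).
  by rewrite -natrM ler_nat; nia.
by rewrite natrD lerD ?ler_nat // natrM ler_wpM2r ?ler0n.
Qed.

Lemma in_G_orders (K : fieldType) (m p q : nat)
    (g : forall i, 'M[fps K]_(tuple_dim m p q i)) i :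
  in_G g -> exists d, has_order d (\det (g i)).
Proof.
move=> /(_ i); rewrite /in_GL /mx_laurent unitmxE det_map_mx unitfE.
by rewrite tofrac_eq0 => /exists_order.
Qed.

Unset Implicit Arguments.

Theorem proposition2p9 (R : realType) (K : fieldType) (hK : perfect_field K)
    (m p q : nat) (hm : (0 < m)%N) (hp : (0 < p)%N) (hq : (0 < q)%N)
    (A : 'I_m -> 'M[K]_(p, q)) (l : R) (hl : (minn p q)%:R <= l) :
  ((ncrk A)%:R)%:E
  = gstable_rank (tnth [tuple (1 : R); 1; l]) (tuple_tensor A).
Proof.
have rl : (ncrk A)%:R <= l by apply: le_trans hl; rewrite ler_nat ncrk_leq_minn.
apply/eqP; rewrite eq_le; apply/andP; split.
  apply: le_ereal_inf_tmp => _ [g [gG gpos] <-]; rewrite /mu_stable.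
  have [d0 og0] := in_G_orders o0 gG; have [d1 og1] := in_G_orders o1 gG.
  have [d2 og2] := in_G_orders o2 gG; rewrite (mu_numerator l og0 og1 og2).
  move: gpos; rewrite val_act_fps.
  have core s := ncrk_le_act (A := A) og0 og1 og2 (s := s).
  have [w0 _|w0] := eqVneq (fps_act g (tuple_tensor A)) 0.
    suff -> : ncrk A = 0%N.
      by rewrite /valt laurent_ffun_eq0 w0 eqxx /= invey mule0.
    (* Every power of t divides 0, so the exponent can be taken large enough to
       force r = 0. *)
    have := core (d2 + (d0 + d1).+1)%N; rewrite addKn => le_s.
    have {le_s} : ((d0 + d1).+1 * ncrk A <= d0 + d1)%N.
      by apply: le_s => J; rewrite w0 ffunE; apply: tdvd0.
    by case: (ncrk A) => // r; nia.
  have [s [-> dvd_s _]] := exists_valt w0; rewrite lte_fin ltz_nat => s0.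
  rewrite -[ext_real _ _]/(s%:R%:E) inver pnatr_eq0 eqn0Ngt s0 /=.
  rewrite -EFinM lee_fin ler_pdivlMr ?ltr0n //.
  by apply: weight_leq rl _; apply: core.
have [g [d0 [d1 [og0 og1 og2 d01 dvd1]]]] := exists_degeneration A.
have gG : in_G g.
  have GL k (h : 'M[fps K]_k) d : has_order d (\det h) -> in_GL h.
    case=> u uu hE; rewrite /in_GL /mx_laurent unitmxE det_map_mx unitfE.
    rewrite tofrac_eq0 hE mulf_neq0 ?fpsXn_neq0 //.
    by apply: contraTneq uu => ->; rewrite unitr0.
  by apply: ord3_ind; [apply: GL og0|apply: GL og1|apply: GL og2].
have le_r : (mu_stable (tnth [tuple (1 : R); 1; l])%R g (tuple_tensor A) <=
             (ncrk A)%:R%:E)%E /\ (0 < val_act g (tuple_tensor A))%E.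
  rewrite /mu_stable (mu_numerator l og0 og1 og2) mulr0 addr0 d01 val_act_fps.
  have [w0|w0] := eqVneq (fps_act g (tuple_tensor A)) 0.
    by rewrite /valt laurent_ffun_eq0 w0 eqxx /= invey mule0 lee_fin ler0n.
  have [s [-> _ /(_ 1 dvd1) s0]] := exists_valt w0; split.
    rewrite -[ext_real _ _]/(s%:R%:E) inver pnatr_eq0 eqn0Ngt s0 /=.
    rewrite -EFinM lee_fin ler_pdivrMr ?ltr0n //.
    by rewrite ler_peMr ?ler0n // ler1n.
  by rewrite lte_fin ltz_nat.
apply: le_trans le_r.1; apply: ereal_inf_lbound; exists g => //.
by split=> //; exact: le_r.2.
Qed.
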